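(* Let $p$ be a prime and let $f\in\mathbb{Q}(x)$ be a normalized Belyi map of combinatorial type $(d; e_1,e_2,e_3)$, where $d = p^n d'$ with $n\ge 0$ and $p\nmid d'$. Then the reduction $\overline{f}$ of $f$ modulo $p$ satisfies $\overline{f}(x) = x^d$ if and only if $e_2\le p^n$.
   Context: A normalized Belyi map of combinatorial type $(d; e_1,e_2,e_3)$ (with integers $2\le e_i\le d$, $e_1+e_2+e_3=2d+1$) is a rational function $f$ of degree $d$, viewed as a map $\mathbb{P}^1\to\mathbb{P}^1$ over $\mathbb{C}$, whose only ramification points are $0,1,\infty$, with ramification indices $e_1,e_2,e_3$ respectively, and with $f(0)=0$, $f(1)=1$, $f(\infty)=\infty$; such $f$ has rational coefficients. Reduction modulo $p$: write $f=f_1/f_2$ with $f_1,f_2\in\mathbb{Z}[x]$ relatively prime, and $f_k = c_k\tilde f_k$ with $c_k$ a nonzero integer and $\tilde f_k\in\mathbb{Z}[x]$ of content $1$. Let $\overline{f}_k\in\mathbb{F}_p[x]$ be the reduction of $\tilde f_k$ and $\overline{f}=\overline{f}_1/\overline{f}_2\in\mathbb{F}_p(x)$ as a rational function (common factors cancelled).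
   Formalization: The constants c_1, c_2 in f_k = c_k f~_k are taken positive instead of merely nonzero; otherwise the reduction is defined only up to sign and the claim fails, e.g. f = 3x^2 - 2x^3, p = 3, c_1 = -1, c_2 = 1 gives -x^3. *)

(* Defs.v *)
From HB Require Import structures.
From mathcomp Require Import all_boot all_order all_algebra.
From mathcomp Require Import complex.
From mathcomp Require Import reals.

Set Implicit Arguments.
Unset Strict Implicit.
Unset Printing Implicit Defensive.

Import Order.TTheory GRing.Theory Num.Theory.
Local Open Scope ring_scope.

Notation "x %:F" := (FracField.tofrac x) (format "x %:F") : ring_scope.

Section RationalFunctions.
Variable K : fieldType.
Implicit Type f : {fraction {poly K}}.

(* [\n_(repr f)] and [\d_(repr f)] need not be coprime, so the common factor
   is divided out; the resulting pair is unique up to a common scalar. *)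
Definition ratnum f : {poly K} :=
  \n_(repr f) %/ gcdp \n_(repr f) \d_(repr f).
Definition ratden f : {poly K} :=
  \d_(repr f) %/ gcdp \n_(repr f) \d_(repr f).

Definition ratdeg f : nat := (maxn (size (ratnum f)) (size (ratden f))).-1.

Inductive proj_line : Type := Fin of K | Infty.
Implicit Type P : proj_line.

(* The value at infinity is the ratio of the coefficients of degree
   [deg (ratden f)], unless the numerator has larger degree. *)
Definition rateval f P : proj_line :=
  match P with
  | Fin a => if (ratden f).[a] == 0 then Infty
             else Fin ((ratnum f).[a] / (ratden f).[a])
  | Infty => if (size (ratden f) < size (ratnum f))%N then Infty
             else Fin ((ratnum f)`_(size (ratden f)).-1
                         / lead_coef (ratden f))
  end.

(* Order of vanishing of [f] at [P], for [f] nonzero. *)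
Definition ratord f P : int :=
  match P with
  | Fin a => (mup a (ratnum f))%:Z - (mup a (ratden f))%:Z
  | Infty => (size (ratden f))%:Z - (size (ratnum f))%:Z
  end.

(* Order of vanishing at [P] of the pullback by [f] of the local parameter
   [t - c] (resp. [1/t]) at the point [f(P) = c] (resp. [f(P)] infinite);
   meaningful for [f] nonconstant. *)
Definition ram_index f P : int :=
  match rateval f P with
  | Fin c => ratord (f - c%:P%:F) P
  | Infty => ratord f^-1 P
  end.

Definition ramified f P : Prop := ram_index f P != 1.

Definition normalized_belyi f (d e1 e2 e3 : nat) : Prop :=
  [/\ [/\ (2 <= e1 <= d)%N, (2 <= e2 <= d)%N, (2 <= e3 <= d)%N
        & (e1 + e2 + e3 = 2 * d + 1)%N],
      ratdeg f = d,
      forall P, ramified f P -> [\/ P = Fin 0, P = Fin 1 | P = Infty],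
      [/\ ram_index f (Fin 0) = e1%:Z, ram_index f (Fin 1) = e2%:Z
        & ram_index f Infty = e3%:Z]
    & [/\ rateval f (Fin 0) = Fin 0, rateval f (Fin 1) = Fin 1
        & rateval f Infty = Infty]].

End RationalFunctions.

Arguments Infty {K}.

Definition ratfunC (R : realType) (f : {fraction {poly rat}}) :
    {fraction {poly R[i]}} :=
  (map_poly ratr (ratnum f))%:F / (map_poly ratr (ratden f))%:F.

Definition rel_prime_Zpoly (g h : {poly int}) : Prop :=
  forall q u v : {poly int}, g = q * u -> h = q * v -> q \is a GRing.unit.

(* [zcontents] carries the sign of the leading coefficient; the content is
   its absolute value. *)
Definition zcontent (g : {poly int}) : nat := `|zcontents g|%N.

Definition redp (p : nat) (g : {poly int}) : {poly 'F_p} :=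
  map_poly (intr : int -> 'F_p) g.

(* [fbar] is the reduction of [f] modulo [p].  The constants [c1] and [c2] are
   taken positive (that is, they are the contents of [f1] and [f2]): with
   arbitrary signs, [fbar] would only be defined up to sign. *)
Definition is_reduction (p : nat) (f : {fraction {poly rat}})
    (fbar : {fraction {poly 'F_p}}) : Prop :=
  exists (f1 f2 : {poly int}) (c1 c2 : int) (g1 g2 : {poly int}),
    [/\ [/\ f2 != 0, rel_prime_Zpoly f1 f2
          & f = (map_poly (intr : int -> rat) f1)%:F
                / (map_poly (intr : int -> rat) f2)%:F],
        [/\ 0 < c1, f1 = c1 *: g1 & zcontent g1 = 1%N],
        [/\ 0 < c2, f2 = c2 *: g2 & zcontent g2 = 1%N]
      & fbar = (redp p g1)%:F / (redp p g2)%:F].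

(* Main.v *)
(** Write [f = P / Q] in lowest terms; then [X^e1] divides [P], [(X - 1)^e2]
    divides [P - Q], [deg P = d] and [deg Q = d - e3].  These divisibilities
    descend to [int] and survive reduction modulo any prime, where they suffice:
    a polynomial of degree less than [e1 + e2] divisible by both [X^e1] and
    [(X - 1)^e2] is zero.  Hence no prime divides exactly one of the contents
    [c1], [c2], so [c1 = c2 = 1] by coprimality.  If [(X - 1)^e2] divides
    [X^d - 1] modulo [p], then it divides [P - X^d Q] modulo [p], which is
    therefore zero; conversely [P = X^d Q] modulo [p] forces [Q] to be constant
    and [P - Q] proportional to [X^d - 1].  Finally
    [X^d - 1 = (X^d' - 1)^(p^n)] modulo [p] has a zero of order exactly [p^n]
    at [1]. *)
Require Import Defs.
From HB Require Import structures.
From mathcomp Require Import all_boot all_order all_algebra.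
From mathcomp Require Import complex.
From mathcomp Require Import reals.
From mathcomp Require Import zify.
Import Order.TTheory GRing.Theory Num.Theory.
Local Open Scope ring_scope.

(** * Fractions in lowest terms and the local data of a Belyi map *)

Lemma tofrac_div_pi (A : idomainType) (a b : A) : b != 0 ->
  a%:F / b%:F = (\pi_({fraction A}) (Ratio a b))%qT.
Proof.
move=> b0; unlock FracField.tofrac.
rewrite -[(_)^-1]FracField.pi_inv -[LHS]FracField.pi_mul.
by rewrite /FracField.mulf /FracField.invf !numden_Ratio ?oner_neq0 // mulr1 mul1r.
Qed.

Lemma tofrac_div_eq (A : idomainType) (a b c : A) : b != 0 ->
  (a%:F / b%:F == c%:F) = (a == c * b).
Proof.
move=> b0; have bF0 : b%:F != 0 by rewrite tofrac_eq0.
by rewrite -(inj_eq (mulIf bF0)) divfK // -tofracM tofrac_eq.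
Qed.

(** Cross-multiplication gives [N * Q = D * P] with both pairs coprime, so by Gauss [D] and [Q]
    divide each other. Hence degrees and orders of [f] can be read off any coprime pair. *)
Lemma ratnum_ratden_coprimep (K : fieldType) (P Q : {poly K}) :
  Q != 0 -> coprimep P Q ->
  exists2 k, k != 0 &
    ratnum (P%:F / Q%:F) = k *: P /\ ratden (P%:F / Q%:F) = k *: Q.
Proof.
move=> Q0 coPQ; rewrite /ratnum /ratden tofrac_div_pi //.
have := FracField.equivf_l (Ratio P Q); rewrite !numden_Ratio //.
move: (denom_ratioP (repr (\pi_({fraction {poly K}}) (Ratio P Q))%qT)).
move: (\n_(repr _)) (\d_(repr _)) => N0 D0 D0_neq0 eqND.
have g0 : gcdp N0 D0 != 0 by rewrite gcdp_eq0 negb_and D0_neq0 orbT.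
have coND : coprimep (N0 %/ gcdp N0 D0) (D0 %/ gcdp N0 D0).
  by rewrite coprimep_div_gcd // D0_neq0 orbT.
have {eqND}: N0 %/ gcdp N0 D0 * Q = D0 %/ gcdp N0 D0 * P.
  apply: (mulIf g0); rewrite mulrAC divpK ?dvdp_gcdl // eqND.
  by rewrite mulrAC divpK ?dvdp_gcdr.
move: (N0 %/ _) (D0 %/ _) coND => N D coND eqND.
have /eqpf_eq[k k0 eqD] : D %= Q.
  apply/andP; split.
    rewrite -(Gauss_dvdpr Q (q := N)) ?eqND ?dvdp_mulr //.
    by rewrite coprimep_sym.
  rewrite -(Gauss_dvdpl D (q := P)) ?(eqP eqND) -?eqND ?dvdp_mull //.
  by rewrite coprimep_sym.
exists k => //; split=> //; apply: (mulIf Q0).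
by rewrite eqND eqD -!scalerAl mulrC.
Qed.

(** The pole at infinity forces [deg Q < deg P], so [deg P = d], and the pole order [e3] is
    [deg P - deg Q]. At 0 and 1 the value is finite, so [Q] does not vanish there and the order is
    that of the numerator of [f], resp. [f - 1]. *)
Lemma normalized_belyi_poly {K : fieldType} {P Q : {poly K}} {d e1 e2 e3} :
    Q != 0 -> coprimep P Q -> normalized_belyi (P%:F / Q%:F) d e1 e2 e3 ->
  [/\ size P = d.+1, (size Q + e3)%N = d.+1, 'X^e1 %| P
    & ('X - 1) ^+ e2 %| P - Q].
Proof.
move=> Q0 coPQ [_ degf _ [ri0 ri1 rioo] [ev0 ev1 evoo]].
have [k k0 [eqN eqD]] := ratnum_ratden_coprimep _ _ _ Q0 coPQ.
have sizePQ : (size Q < size P)%N.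
  by move: evoo; rewrite /rateval eqN eqD !size_scale //; case: ifP.
have P0 : P != 0 by rewrite -size_poly_gt0 (leq_ltn_trans _ sizePQ).
have sizeP : size P = d.+1.
  move: degf; rewrite /ratdeg eqN eqD !size_scale // (maxn_idPl (ltnW sizePQ)) => <-.
  by rewrite prednK // size_poly_gt0.
have sizeQ : (size Q + e3)%N = d.+1.
  move: rioo; rewrite /ram_index evoo /ratord invf_div.
  have [|l l0 [-> ->]] := ratnum_ratden_coprimep _ Q P P0.
    by rewrite coprimep_sym.
  rewrite !size_scale // sizeP => /eqP; rewrite subr_eq -PoszD => /eqP[->].
  by rewrite addnC.
split=> //.
- move: ri0; rewrite /ram_index ev0 /ratord tofrac0 subr0 eqN eqD.
  rewrite [mup 0 (k *: Q)]mupNroot; last first.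
    move: ev0; rewrite /rateval eqD /root.
    by case: ifP => // /negbT.
  rewrite subr0 => -[mupP].
  rewrite -[X in X ^+ _]subr0 -polyC0 -(dvdpZr _ _ k0) -mup_geq ?mupP //.
  by rewrite scaler_eq0 negb_or k0.
- have PQ0 : P - Q != 0.
    by rewrite subr_eq0; apply: contraTneq sizePQ => ->; rewrite ltnn.
  move: ri1; rewrite /ram_index ev1 /ratord.
  have -> : P%:F / Q%:F - 1%:P%:F = (P - Q)%:F / Q%:F.
    by rewrite tofracB mulrBl divff ?tofrac_eq0 // polyC1 tofrac1.
  have [|l l0 [-> ->]] := ratnum_ratden_coprimep _ (P - Q) Q Q0.
    by rewrite coprimep_sym addrC -mulN1r coprimep_addl_mul coprimep_sym.
  rewrite [mup 1 (l *: Q)]mupNroot; last first.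
    move: ev1; rewrite /rateval eqD /root !hornerZ !mulf_eq0 (negPf k0) (negPf l0).
    by case: ifP => // /negbT.
  rewrite subr0 => -[mupP].
  rewrite -polyC1 -(dvdpZr _ _ l0) -mup_geq ?mupP //.
  by rewrite scaler_eq0 negb_or l0.
Qed.

(** * Coprimality and divisibility between integer and complex coefficients *)

Lemma rel_prime_Zpoly_coprimep g h : g != 0 ->
  rel_prime_Zpoly g h -> coprimep g h.
Proof.
move=> g0 rel_gh; rewrite coprimep_def.
(* The common factor over the integers is the primitive part of the gcd, which has the same size as
   the gcd; being a unit, it is constant. *)
have [u eqg] := dvdpP_int (dvdp_gcdl g h).
have [v eqh] := dvdpP_int (dvdp_gcdr g h).
have := rel_gh _ _ _ eqg eqh.
by rewrite poly_unitE size_zprimitive => /andP[].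
Qed.

Lemma map_poly_intr_ratr (C : numFieldType) (g : {poly int}) :
  map_poly (ratr : rat -> C) (map_poly intr g) = map_poly intr g.
Proof. by rewrite -map_poly_comp; apply: eq_map_poly => x /=; rewrite ratr_int. Qed.

Lemma coprimep_intr (C : numFieldType) (g h : {poly int}) :
  coprimep g h -> coprimep (map_poly (intr : int -> C) g) (map_poly intr h).
Proof.
case/Bezout_coprimepP => -[u v] /=; rewrite -size_poly_eq1 => uv1.
apply/Bezout_coprimepP; exists (map_poly intr u, map_poly intr v) => /=.
rewrite -!rmorphM -rmorphD -size_poly_eq1 size_map_poly_id0 //.
by rewrite intr_eq0 lead_coef_eq0 -size_poly_gt0 (eqP uv1).
Qed.

(** Divisibility descends to the rationals, then by Gauss's lemma to the primitive part of [m],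
    which is [m] itself. *)
Lemma dvdp_intr_monic (C : numFieldType) (m g : {poly int}) :
  m \is monic -> map_poly (intr : int -> C) m %| map_poly intr g ->
  exists q, g = q * m.
Proof.
move=> mon_m; rewrite -(map_poly_intr_ratr C m) -(map_poly_intr_ratr C g).
rewrite dvdp_map dvdp_rat_int.
move=> /dvdpP_int[q ->]; exists q; rewrite mulrC; congr (_ * _).
by rewrite [RHS]zpolyEprim zcontents_monic // scale1r.
Qed.

(** * Contact at 0 and 1 over an arbitrary field *)

Lemma dvdp_XsubCX_Xn_sub1 (F : fieldType) p d n e :
    p \in [pchar F] -> ~~ (p %| d)%N ->
  (('X - 1) ^+ e %| ('X^(p ^ n * d) - 1 : {poly F})) = (e <= p ^ n)%N.
Proof.
move=> pF p'd; have pP : p \in [pchar {poly F}] by rewrite pchar_poly.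
have -> : 'X^(p ^ n * d) - 1 = ('X^d - 1 : {poly F}) ^+ (p ^ n).
  rewrite mulnC exprM; elim: n => [|n IHn]; first by rewrite !expn0 !expr1.
  by rewrite expnSr !exprM -IHn -!(pFrobenius_autE pP) rmorphB rmorph1.
(* 1 is a simple root: the cofactor takes the value [d] at 1, nonzero as [p] does not divide [d]. *)
have [S [-> S1]] : exists S : {poly F}, 'X^d - 1 = S * ('X - 1) /\ S.[1] != 0.
  exists (\sum_(i < d) 'X^i); split; first by rewrite mulrC -subrX1.
  rewrite horner_sum (eq_bigr (fun=> 1)) => [|i _]; last by rewrite hornerXn expr1n.
  by rewrite sumr_const card_ord -(dvdn_pcharf pF).
have S0 : S != 0 by apply: contraNneq S1 => ->; rewrite horner0.
rewrite -!polyC1 exprMn -mup_geq ?mulf_neq0 ?expf_neq0 ?polyXsubC_eq0 //.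
by rewrite mupMr ?mup_XsubCX ?eqxx // /root horner_exp expf_neq0.
Qed.

Lemma coprimep_X_Xsub1 (F : fieldType) e1 e2 :
  coprimep ('X^e1 : {poly F}) (('X - 1) ^+ e2).
Proof.
by rewrite coprimep_expl ?coprimep_expr // coprimep_sym coprimepX
  rootE !hornerE oppr_eq0 oner_neq0.
Qed.

Lemma dvdp_Xsub1X_leq (F : fieldType) e (q : {poly F}) :
  q != 0 -> ('X - 1) ^+ e %| q -> (e < size q)%N.
Proof. by move=> q0 /(dvdp_leq q0); rewrite -polyC1 size_exp_XsubC. Qed.

Lemma dvdp_X_Xsub1_leq (F : fieldType) e1 e2 (q : {poly F}) :
  q != 0 -> 'X^e1 %| q -> ('X - 1) ^+ e2 %| q -> (e1 + e2 < size q)%N.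
Proof.
move=> q0 q1 q2; have : 'X^e1 * ('X - 1) ^+ e2 %| q.
  by rewrite Gauss_dvdp ?q1 ?q2 ?coprimep_X_Xsub1.
move=> /(dvdp_leq q0); rewrite -polyC1 size_proper_mul ?size_polyXn.
  by rewrite size_exp_XsubC addSn addnS.
rewrite lead_coefXn mul1r lead_coef_eq0 expf_neq0 //.
by rewrite polyXsubC_eq0.
Qed.

(** If only one coefficient vanished, [('X - 1) ^+ e2] would divide [P] or [Q]. But
    [deg Q <= d - e3 < e2], and [deg P <= d < e1 + e2]. It is meant for [a], [b] the residues of the
    contents. *)
Lemma pencil_coef_eq0 (F : fieldType) (P Q : {poly F}) (a b : F) d e1 e2 e3 :
    (e1 <= d)%N -> (e3 <= d)%N -> (e1 + e2 + e3 = 2 * d + 1)%N ->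
    P != 0 -> Q != 0 -> (size P <= d.+1)%N -> (size Q + e3 <= d.+1)%N ->
    'X^e1 %| P -> ('X - 1) ^+ e2 %| a *: P - b *: Q ->
  (a == 0) = (b == 0).
Proof.
move=> e1d e3d sume P0 Q0 sizeP sizeQ XP; apply: contraTeq => ab.
have [a0 | a0] := eqVneq a 0; have [b0 | b0] := eqVneq b 0.
- by rewrite a0 b0 !eqxx in ab.
- rewrite a0 scale0r sub0r dvdpNr dvdpZr //; apply: contraL sizeQ.
  by move=> /(dvdp_Xsub1X_leq _ _ _ Q0); lia.
- rewrite b0 scale0r subr0 dvdpZr //; apply: contraL sizeP.
  by move=> /(dvdp_X_Xsub1_leq _ _ _ _ P0 XP); lia.
- by rewrite (negPf a0) (negPf b0) in ab.
Qed.

Lemma eq_mulXn_of_contact (F : fieldType) (P Q : {poly F}) d e1 e2 e3 :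
    (e1 <= d)%N -> (e3 <= d)%N -> (e1 + e2 + e3 = 2 * d + 1)%N ->
    (size P <= d.+1)%N -> (size Q + e3 <= d.+1)%N ->
    'X^e1 %| P -> ('X - 1) ^+ e2 %| P - Q -> ('X - 1) ^+ e2 %| ('X^d - 1 : {poly F}) ->
  P = 'X^d * Q.
Proof.
move=> e1d e3d sume sizeP sizeQ XP PQ Xd; apply/eqP; rewrite -subr_eq0.
apply: contraT => nz.
have : (e1 + e2 < size (P - 'X^d * Q)%R)%N.
  apply: dvdp_X_Xsub1_leq => //.
    by rewrite dvdp_sub // dvdp_mulr // dvdp_exp2l.
  have -> : P - 'X^d * Q = (P - Q) - ('X^d - 1) * Q.
    by rewrite mulrBl mul1r opprB addrA subrK.
  by rewrite dvdp_sub // dvdp_mulr.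
(* The degree is at most [2 * d - e3 = e1 + e2 - 1], just below the bound. *)
have sizeB : (size (P - 'X^d * Q)%R <= maxn (size P) (size ('X^d * Q)%R))%N.
  by rewrite -(size_polyN ('X^d * Q)) size_polyD.
have sizeM : (size ('X^d * Q)%R <= d + size Q)%N.
  by rewrite (leq_trans (size_polyMleq _ _)) // size_polyXn.
by move: (size _) (size ('X^d * Q)) sizeB sizeM => s t; lia.
Qed.

Lemma eq_mulXn_contact (F : fieldType) (P Q : {poly F}) d e :
  Q != 0 -> (size P <= d.+1)%N -> P = 'X^d * Q ->
  ('X - 1) ^+ e %| P - Q -> ('X - 1) ^+ e %| ('X^d - 1 : {poly F}).
Proof.
move=> Q0 + eqPQ.
rewrite eqPQ mulrC size_mulXn // -[X in (_ <= X)%N]addn1 leq_add2l => sQ.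
rewrite -{2}(mulr1 Q) -mulrBr [Q](size1_polyC sQ) mul_polyC dvdpZr //.
by rewrite -polyC_eq0 -size1_polyC.
Qed.

(** * Contents, reduction modulo a prime, and the integral form of a Belyi map *)

Lemma redp_neq0 p g : prime p -> zcontent g = 1%N -> redp p g != 0.
Proof.
move=> p_pr cg; apply/eqP => /polyP red0.
have : (p %| zcontents g)%Z.
  rewrite dvdz_contents; apply/polyOverP => i.
  by rewrite (dvdz_pcharf (pchar_Fp p_pr)) -coef_map /= red0 coef0.
by rewrite dvdzE /= -/(zcontent g) cg dvdn1; case: eqP p_pr => // ->.
Qed.

(** A common prime would be a constant common factor, and it is not a unit of [{poly int}]. *)
Lemma rel_prime_Zpoly_scale (c1 c2 : int) g1 g2 p : prime p ->
  rel_prime_Zpoly (c1 *: g1) (c2 *: g2) -> ~~ ((p %| c1)%Z && (p %| c2)%Z).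
Proof.
move=> p_pr rel; apply/negP => /andP[/dvdzP[a eqa] /dvdzP[b eqb]].
have := rel p%:Z%:P (a *: g1) (b *: g2).
rewrite -!mul_polyC eqa eqb !polyCM ![_ * p%:Z%:P]mulrC !mulrA => /(_ erefl erefl).
rewrite poly_unitE coefC eqxx => /andP[_].
case/unitrP => x [xp _]; have /dvdnP[k] : (p %| 1)%N.
  by move: (congr1 absz xp); rewrite abszM => xp1; apply/dvdnP; exists `|x|%N.
by move=> /esym/eqP; rewrite muln_eq1 => /andP[_ /eqP p1]; rewrite p1 in p_pr.
Qed.

Lemma map_poly_intr_eq0 (C : numFieldType) (g : {poly int}) :
  (map_poly (intr : int -> C) g == 0) = (g == 0).
Proof.
have [-> | g0] := eqVneq g 0; first by rewrite rmorph0 eqxx.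
by rewrite map_poly_eq0_id0 ?(negPf g0) // intr_eq0 lead_coef_eq0.
Qed.

Lemma ratfunC_intr (R : realType) (g h : {poly int}) :
  h != 0 -> coprimep g h ->
  ratfunC R ((map_poly intr g)%:F / (map_poly intr h)%:F)
    = (map_poly intr g)%:F / (map_poly intr h)%:F.
Proof.
move=> h0 co; have hQ0 : map_poly (intr : int -> rat) h != 0.
  by rewrite map_poly_intr_eq0.
have [k k0 [eqN eqD]] := ratnum_ratden_coprimep _ _ _ hQ0 (coprimep_intr _ _ _ co).
rewrite /ratfunC eqN eqD !map_polyZ /= !map_poly_intr_ratr -!mul_polyC !tofracM.
rewrite invfM mulrACA divff ?mul1r // tofrac_eq0 polyC_eq0.
by rewrite fmorph_eq0.
Qed.

(** The divisors are monic, so divisibility descends from [R[i]]. Explicit integral cofactors are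
    stated because such identities can be reduced modulo every prime. *)
Lemma normalized_belyi_int (R : realType) (g1 g2 : {poly int}) (c1 c2 : int)
    d e1 e2 e3 :
    c1 != 0 -> c2 != 0 -> g1 != 0 -> g2 != 0 ->
    rel_prime_Zpoly (c1 *: g1) (c2 *: g2) ->
    normalized_belyi (ratfunC R ((map_poly intr (c1 *: g1))%:F
                                 / (map_poly intr (c2 *: g2))%:F)) d e1 e2 e3 ->
  [/\ size g1 = d.+1, (size g2 + e3)%N = d.+1, exists q, g1 = q * 'X^e1
    & exists q, c1 *: g1 - c2 *: g2 = q * ('X - 1) ^+ e2].
Proof.
move=> c10 c20 g10 g20 rel.
have f10 : c1 *: g1 != 0 by rewrite -mul_polyC mulf_neq0 ?polyC_eq0.
have f20 : c2 *: g2 != 0 by rewrite -mul_polyC mulf_neq0 ?polyC_eq0.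
have co := rel_prime_Zpoly_coprimep _ _ f10 rel.
have f2C0 : map_poly (intr : int -> R[i]) (c2 *: g2) != 0.
  by rewrite map_poly_intr_eq0.
rewrite ratfunC_intr //.
case/(normalized_belyi_poly f2C0 (coprimep_intr _ _ _ co)).
have size_intr (g : {poly int}) : size (map_poly (intr : int -> R[i]) g) = size g.
  have [-> | g0] := eqVneq g 0; first by rewrite rmorph0 !size_poly0.
  by rewrite size_map_poly_id0 // intr_eq0 lead_coef_eq0.
have cC0 (c : int) : c != 0 -> c%:~R != 0 :> R[i] by rewrite intr_eq0.
rewrite -rmorphB /= [map_poly _ (c1 *: g1)]map_polyZ.
rewrite [map_poly _ (c2 *: g2)]map_polyZ /=.
rewrite !size_scale ?cC0 // !size_intr dvdpZr ?cC0 // => -> -> X1 X2; split=> //.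
  apply: (dvdp_intr_monic R[i]); first exact: monicXn.
  by rewrite map_polyXn.
apply: (dvdp_intr_monic R[i]).
  by rewrite monic_exp // -polyC1 monicXsubC.
by rewrite rmorphXn rmorphB /= rmorph1 map_polyX.
Qed.

Theorem theorem5p5 (R : realType) (p d d' n e1 e2 e3 : nat)
    (f : {fraction {poly rat}}) (fbar : {fraction {poly 'F_p}})
    (p_prime : prime p)
    (belyi_f : normalized_belyi (ratfunC R f) d e1 e2 e3)
    (d_eq : d = (p ^ n * d')%N) (p_ndvd : ~~ (p %| d')%N)
    (red_f : is_reduction f fbar) :
  fbar = ('X^d)%:F <-> (e2 <= p ^ n)%N.
Proof.
have [[/andP[_ e1d] _ /andP[_ e3d] sume] _ _ _ _] := belyi_f.
have [f1 [f2 [c1 [c2 [g1 [g2 [[_ rel eqf]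
  [c1_gt0 eqf1 cg1] [c2_gt0 eqf2 cg2] eqfbar]]]]]]] := red_f.
move: rel belyi_f; rewrite eqf {}eqf1 {}eqf2 => rel belyi_f.
have g_neq0 g : zcontent g = 1%N -> g != 0.
  by move=> cg; apply/eqP => g0; rewrite g0 /zcontent zcontents0 in cg.
have [sg1 sg2 [q1 eqg1] [q2 eqg12]] :=
  normalized_belyi_int _ _ _ _ _ _ _ _ _ (lt0r_neq0 c1_gt0) (lt0r_neq0 c2_gt0)
    (g_neq0 _ cg1) (g_neq0 _ cg2) rel belyi_f.
(* Reduction may lower degrees, so only upper bounds are kept. *)
have size_red q g : (size (redp q g) <= size g)%N by exact: size_poly.
have size1 q : (size (redp q g1) <= d.+1)%N by rewrite -sg1.
have size2 q : (size (redp q g2) + e3 <= d.+1)%N by rewrite -sg2 leq_add2r.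
have X_g1 q : 'X^e1 %| redp q g1.
  by rewrite eqg1 /redp rmorphM /= map_polyXn dvdp_mull.
have contact q : ('X - 1) ^+ e2 %| c1%:~R *: redp q g1 - c2%:~R *: redp q g2.
  rewrite /redp -!map_polyZ -rmorphB /= eqg12 rmorphM rmorphXn rmorphB /=.
  by rewrite rmorph1 map_polyX dvdp_mull.
(* All primes [q] are treated, not just [p], since the contents are to be shown equal to 1. *)
have c1c2 q : prime q -> (q %| c1)%Z = (q %| c2)%Z.
  move=> q_pr; rewrite !(dvdz_pcharf (pchar_Fp q_pr)).
  exact: pencil_coef_eq0 e1d e3d sume (redp_neq0 _ _ q_pr cg1)
    (redp_neq0 _ _ q_pr cg2) (size1 q) (size2 q) (X_g1 q) (contact q).
have eq1 (c : int) : 0 < c -> (forall q, prime q -> ~~ (q %| c)%Z) -> c = 1.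
  move=> c_gt0 nq; rewrite -(gtz0_abs c_gt0); congr Posz.
  apply/eqP; rewrite eqn_leq absz_gt0 gt_eqF // andbT leqNgt.
  by apply/negP => /pdiv_prime/nq; rewrite dvdzE /= pdiv_dvd.
have c1E : c1 = 1.
  apply: eq1 => // q q_pr.
  by have := rel_prime_Zpoly_scale _ _ _ _ _ q_pr rel; rewrite -c1c2 // andbb.
have c2E : c2 = 1.
  apply: eq1 => // q q_pr.
  by have := rel_prime_Zpoly_scale _ _ _ _ _ q_pr rel; rewrite c1c2 // andbb.
have {}contact : ('X - 1) ^+ e2 %| redp p g1 - redp p g2.
  by have := contact p; rewrite c1E c2E !scale1r.
have g20 := redp_neq0 _ _ p_prime cg2.
(* The bound on [e2] becomes divisibility of ['X^d - 1] by [('X - 1) ^+ e2], and [fbar = ('X^d)%:F]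
   becomes [redp p g1 = 'X^d * redp p g2]. *)
rewrite -(dvdp_XsubCX_Xn_sub1 _ _ _ _ _ (pchar_Fp p_prime) p_ndvd) -d_eq eqfbar.
split=> [/eqP | Xd].
  rewrite tofrac_div_eq // => /eqP eqg.
  exact: eq_mulXn_contact g20 (size1 p) eqg contact.
by apply/eqP; rewrite tofrac_div_eq //; apply/eqP;
  exact: eq_mulXn_of_contact e1d e3d sume (size1 p) (size2 p) (X_g1 p) contact Xd.
Qed.
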